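(* Let $n\ge2$ and let $\mathcal{H}=(I,P_2,\dots,P_{n-1},P,Q)$ be a connected $n$-ary quasigroupoid with $|I|\ge n+3$, equipped with an $(n+2)$-homogeneous regular action of a group $G$ (written additively). Then: (1) if $n$ is odd, there is some $g\in G$ such that, defining a relation $Q_g$ on $P$ by $Q_g(p_1,\dots,p_{n+1})\iff Q(p_1,\dots,p_n,p_{n+1}-g)$, the quasigroupoid $\mathcal{H}_g=(I,P_2,\dots,P_{n-1},P,Q_g)$ is an $n$-ary polygroupoid; (2) if $n$ is even, then $\mathcal{H}$ is an $n$-ary polygroupoid.
   Context: Structures: sorts $P_1=I,P_2,\dots,P_n=P$ with functions $\pi^k:P_k\to(P_{k-1})^k$ ($2\le k\le n$), $\pi^k_i(f)$ the $i$-th coordinate. A tuple $(f_1,\dots,f_{k+1})\in(P_k)^{k+1}$ is compatible if $k=1$ and $f_1\ne f_2$, or $k\ge2$ and $\pi^k_i(f_j)=\pi^k_{j-1}(f_i)$ for all $1\le i<j\le k+1$. For a set $X$, $X^{(k)}$ denotes $k$-tuples of pairwise distinct elements. With all $\pi^k(f)$ compatible, $f\in P_i$ is over $(a_1,\dots,a_i)\in I^{(i)}$ if $i=2$ and $\pi^2(f)=(a_1,a_2)$, or $i>2$ and each $\pi^i_j(f)$ is over $(a_1,\dots,\widehat{a_j},\dots,a_i)$; $P_i(w)$ is the set of $f\in P_i$ over $w$. An $n$-ary quasigroupoid is such a structure with $Q\subseteq P^{n+1}$ such that every $\pi^k(f)$ is compatible, every $Q$-tuple is compatible, and if $Q(p_1,\dots,p_{n+1})$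 then each $p_i$ is the unique $x$ with $Q(p_1,\dots,p_{i-1},x,p_{i+1},\dots,p_{n+1})$. Connected: (a) for $i\in\{1,\dots,n-1\}$ every compatible $(i+1)$-tuple from $P_i$ lies in the image of $\pi^{i+1}$; (b) for every compatible $(n+1)$-tuple $(p_1,\dots,p_{n+1})$ from $P$ and every $i$ there is $p_i'$ with $Q(p_1,\dots,p_i',\dots,p_{n+1})$. $n$-ary polygroupoid: additionally associative, i.e. whenever $\{p^i_j:1\le i\le n+2,1\le j\le n+1\}\subseteq P$ with each $(p^i_1,\dots,p^i_{n+1})$ compatible and $p^i_j=p^{j+1}_i$ for $1\le i\le j\le n+1$, then for each $\ell$, if $Q(p^i_1,\dots,p^i_{n+1})$ for all $i\ne\ell$ then $Q(p^\ell_1,\dots,p^\ell_{n+1})$. Regular action of $G$: an action on $P$ with $\pi^n(g+p)=\pi^n(p)$, regular (transitive, trivial stabilizers) on each fiber of $\pi^n$, and $Q(p_1,\dots,p_{n+1})$ implies $Q(p_1,\dots,p_{i-1},g+p_i,g+p_{i+1},p_{i+2},\dots,p_{n+1})$ for all $g\in G$, $i\in\{1,\dots,n\}$. The support $\mathrm{supp}(X)$ of $X\subseteq I\cup P_2\cup\dots\cup P$ is the subset of $I$ generated from $X$ by the maps $\pi^i_j$; the closure $\operatorname{cl}(X)=\mathrm{supp}(X)\cup\bigcup_{2\le i\le n}\bigcup_{w\in\mathrm{supp}(X)^{(i)}}P_i(w)$, viewed as a substructure (restricting $\pi$'s and $Q$). A family $(A_1,\dots,A_{n-1})$ with $A_k\subseteq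 P_k$ is a maximal compatible system (going up to $P_{n-1}$) if it is closed under projections ($\pi^{k+1}_j(a)\in A_k$ for $a\in A_{k+1}$) and for each $2\le k\le n-1$ and each $w\in A_1^{(k)}$, $A_k\cap P_k(w)$ has exactly one element. The action is $(n+2)$-homogeneous if whenever $\bar a=(a_1,\dots,a_{n+2}),\bar b=(b_1,\dots,b_{n+2})\in I^{(n+2)}$ and $(A_1,\dots,A_{n-1})$, $(B_1,\dots,B_{n-1})$ are maximal compatible systems with $A_1=\{a_1,\dots,a_{n+2}\}$, $B_1=\{b_1,\dots,b_{n+2}\}$, there is an isomorphism $f:\operatorname{cl}(\bar a)\to\operatorname{cl}(\bar b)$ with $f(a_i)=b_i$, $f(A_k)=B_k$ for all $k$, and $f$ commuting with the action of $G$.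
   Formalization: ''f in P_2 is over (a_1,a_2)'' is read as π²(f)=(a_2,a_1), so that the j-th projection omits the j-th vertex; with the literal π²(f)=(a_1,a_2), compatibility makes P_3(w) empty for all w of distinct points, and the claim fails for n≥4. *)

(* Defs.v *)
From HB Require Import structures.
From mathcomp Require Import all_boot.
From mathcomp Require Import boolp classical_sets functions.

Set Implicit Arguments.
Unset Strict Implicit.
Unset Printing Implicit Defensive.

Local Open Scope classical_set_scope.

(* [psort H k] is the sort P_k, so [psort H 1] is I and [psort H n] is P, and
   [proj f i] is the (i+1)-st coordinate of pi^k(f), positions being counted
   from 0.  Only the sorts 1 <= k <= n and the maps pi^k with 2 <= k <= n belong
   to the structure: the fields are total in k merely to avoid proof arguments,
   and no definition below looks at the other values.
   Tuples are functions on ordinals. *)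
Record structure (n : nat) := Structure {
  psort : nat -> Type;
  proj : forall k, psort k -> 'I_k -> psort k.-1;
  qrel : ('I_n.+1 -> psort n) -> Prop }.

Arguments psort {n} _ _.
Arguments proj {n _ k} _ _.
Arguments qrel {n} _ _.

Definition upd {k : nat} {T : Type} (t : 'I_k -> T) (i : 'I_k) (x : T) :
    'I_k -> T :=
  fun j => if j == i then x else t j.

Section Structures.
Context {n : nat}.
Implicit Types H : structure n.

(* The pair (i, j) below stands for the 1-based pair (i+1, j+2), so that i <= j
   is the strict inequality between the two positions. *)
Definition compatible H (k : nat) (t : 'I_k.+1 -> psort H k) : Prop :=
  (k = 1 /\ t ord0 <> t ord_max) \/
  (2 <= k /\ forall i j : 'I_k, i <= j ->
     proj (t (lift ord0 j)) i = proj (t (widen_ord (leqnSn k) i)) j).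

Definition quasigroupoid H : Prop :=
  [/\ forall (k : nat) (f : psort H k.+1), 1 <= k < n ->
        @compatible H k (proj f),
      forall p : 'I_n.+1 -> psort H n, qrel H p -> compatible p
    & forall p : 'I_n.+1 -> psort H n, qrel H p ->
        forall i, unique (fun x => qrel H (upd p i x)) (p i)].

Definition connected H : Prop :=
  (forall (k : nat) (t : 'I_k.+1 -> psort H k), 1 <= k < n -> compatible t ->
     exists f : psort H k.+1, proj f = t) /\
  (forall p : 'I_n.+1 -> psort H n, compatible p ->
     forall i, exists x, qrel H (upd p i x)).

Definition associative_law H : Prop :=
  forall p : 'I_n.+2 -> 'I_n.+1 -> psort H n,
    (forall i, compatible (p i)) ->
    (forall i j : 'I_n.+1, i <= j ->
       p (widen_ord (leqnSn n.+1) i) j = p (lift ord0 j) i) ->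
    forall l, (forall i, i != l -> qrel H (p i)) -> qrel H (p l).

Definition polygroupoid H : Prop := quasigroupoid H /\ associative_law H.

(* For f in P_2 the compatibility identities force the simplicial convention
   that the j-th projection omits the j-th vertex, i.e. f over (a_1, a_2) means
   pi^2_1(f) = a_2 and pi^2_2(f) = a_1.  With the opposite order in this base
   case, no f in P_k with k >= 3 would be over any tuple of distinct points. *)
Fixpoint lies_over H (k : nat) : psort H k -> ('I_k -> psort H 1) -> Prop :=
  match k return psort H k -> ('I_k -> psort H 1) -> Prop with
  | k'.+1 =>
    match k' as m
      return (psort H m -> ('I_m -> psort H 1) -> Prop) ->
             psort H m.+1 -> ('I_m.+1 -> psort H 1) -> Prop with
    | 0 => fun _ _ _ => False
    | 1 => fun _ f w => proj f ord0 = w ord_max /\ proj f ord_max = w ord0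
    | _ => fun over_k' f w =>
             forall j, over_k' (proj f j) (fun i => w (lift j i))
    end (@lies_over H k')
  | 0 => fun _ _ => False
  end.

Definition fiber_over H (k : nat) (w : 'I_k -> psort H 1) : set (psort H k) :=
  [set f | lies_over f w].

Inductive generated H (X : forall k, set (psort H k)) :
    forall k, psort H k -> Prop :=
| gen_base k (f : psort H k) : 1 <= k <= n -> X k f -> generated X f
| gen_proj k (f : psort H k) (j : 'I_k) :
    2 <= k <= n -> generated X f -> generated X (proj f j).

Definition supp H (X : forall k, set (psort H k)) : set (psort H 1) :=
  [set a | generated X a].

Definition cl H (X : forall k, set (psort H k)) (k : nat) : set (psort H k) :=
  match k return set (psort H k) with
  | 0 => set0
  | 1 => supp X
  | k'.+2 => [set f | k'.+2 <= n /\
               exists w : 'I_k'.+2 -> psort H 1,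
                 [/\ injective w, forall i, supp X (w i) & fiber_over w f]]
  end.

Arguments cl {H} X k _.

Definition points H (m : nat) (a : 'I_m -> psort H 1) (k : nat) :
    set (psort H k) :=
  match k return set (psort H k) with
  | 1 => range a
  | _ => set0
  end.

Arguments points {H m} a k _.

(* An isomorphism between the substructures with universes C and D; the values
   of f outside C are irrelevant. *)
Definition substructure_iso H (C D : forall k, set (psort H k))
    (f : forall k, psort H k -> psort H k) : Prop :=
  [/\ forall k, 1 <= k <= n -> set_bij (C k) (D k) (f k),
      forall k (x : psort H k) (j : 'I_k), 2 <= k <= n -> C k x ->
        f k.-1 (proj x j) = proj (f k x) j
    & forall p : 'I_n.+1 -> psort H n, (forall i, C n (p i)) ->
        (qrel H p <-> qrel H (fun i => f n (p i)))].

(* Only the components A_1, ..., A_(n-1) of the family are relevant. *)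
Definition maximal_compatible_system H (A : forall k, set (psort H k)) : Prop :=
  (forall k (a : psort H k.+1) (j : 'I_k.+1), 1 <= k -> k.+1 <= n.-1 ->
     A k.+1 a -> A k (proj a j)) /\
  (forall k (w : 'I_k -> psort H 1), 2 <= k <= n.-1 ->
     injective w -> (forall i, A 1 (w i)) ->
     exists! f, (A k `&` fiber_over w) f).

(* G is not assumed commutative, hence the library's multiplicative notation:
   g + p is [act g p] and p - g is [act g^-1 p]. *)
Definition regular_action H (G : groupType)
    (act : G -> psort H n -> psort H n) : Prop :=
  [/\ (forall p, act 1%g p = p) /\
        (forall g h p, act (g * h)%g p = act g (act h p)),
      forall g p, proj (act g p) = proj p,
      forall p q, proj p = proj q -> exists g, act g p = q,
      forall g p, act g p = p -> g = 1%g
    & forall (g : G) (p : 'I_n.+1 -> psort H n) (i : 'I_n), qrel H p ->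
        qrel H (fun j => if (j == i :> nat) || (j == i.+1 :> nat)
                        then act g (p j) else p j)].

Definition homogeneous_action H (G : groupType)
    (act : G -> psort H n -> psort H n) : Prop :=
  forall (a b : 'I_n.+2 -> psort H 1) (A B : forall k, set (psort H k)),
    injective a -> injective b ->
    maximal_compatible_system A -> maximal_compatible_system B ->
    A 1 = range a -> B 1 = range b ->
    exists f : forall k, psort H k -> psort H k,
      [/\ substructure_iso (cl (points a)) (cl (points b)) f,
          forall i, f 1 (a i) = b i,
          forall k, 1 <= k <= n.-1 -> f k @` A k = B k
        & forall g p, cl (points a) n p -> f n (act g p) = act g (f n p)].

Definition twist H (G : groupType) (act : G -> psort H n -> psort H n) (g : G) :
    structure n :=
  @Structure n (psort H) (@proj n H)
    (fun p => qrel H (upd p ord_max (act g^-1%g (p ord_max)))).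

End Structures.

Arguments cl {n H} X k _.
Arguments points {n H m} a k _.

(* Main.v *)
Require Import Defs.
From HB Require Import structures.
From mathcomp Require Import all_boot all_algebra zify.
From mathcomp Require Import boolp classical_sets functions.
From mathcomp Require Import fintype finset.

(* Whenever [p] is a compatible tuple there is a unique [v] in [G] (its defect)
   such that adding [v] to the last entry gives a Q-tuple, and [G] is abelian.
   The family [p^i_j] of the associativity law is the boundary of an
   (n+1)-simplex; call the alternating sum of the defects of its rows its
   boundary.  Every n-simplex occurs in two rows with opposite signs, so the
   boundary only depends on the (n-1)-skeleton.  The skeleton extends to a
   maximal compatible system, hence by homogeneity all families have the same
   boundary [c].  Summing over the n+3 faces of an (n+2)-simplex gives
   [c - c + ... = 0], that is [c = 0] for n even; for n odd, twisting adds a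
   constant to all n+2 defects and cancels [c]. *)

Set Implicit Arguments.
Unset Strict Implicit.
Unset Printing Implicit Defensive.

Import GRing.Theory.

(** * Alternating sums and cancellation in double sums *)

Lemma ltn_lift m (i : 'I_m.+1) : {homo lift i : x y / (x < y)%N}.
Proof.
case: i => i ? [x ?] [y ?] /= xy; rewrite /bump.
by case: (leqP i x) => ?; case: (leqP i y) => ? /=; lia.
Qed.

(** The cosimplicial identity: both sides enumerate in increasing order the positions other than [i]
    and [j + 1]. *)
Lemma lift_lift m (i j : 'I_m.+1) (x : 'I_m) : (i <= j)%N ->
  lift (widen_ord (leqnSn m.+1) i) (lift j x) = lift (lift ord0 j) (lift i x).
Proof.
move=> ij; apply: val_inj => /=; rewrite /bump /=.
by do ?[case: leqP => /= ?]; lia.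
Qed.

Definition altsum (V : zmodType) m (g : 'I_m -> V) : V :=
  (\sum_(i < m) (if odd i then - g i else g i))%R.

(** Think of [p i j] as attached to the simplex without the vertices [i] and [lift i j]; the
    condition makes it depend on the unordered pair alone. *)
Definition symmetric_family m (T : Type) (p : 'I_m.+1 -> 'I_m -> T) : Prop :=
  forall i j : 'I_m, (i <= j)%N ->
    p (widen_ord (leqnSn m) i) j = p (lift ord0 j) i.

Section AlternatingSums.
Context {V : zmodType}.
Local Open Scope ring_scope.

Lemma altsumD m (g h : 'I_m -> V) :
  altsum (fun i => g i + h i) = altsum g + altsum h.
Proof.
rewrite /altsum -big_split; apply: eq_bigr => i _ /=.
by case: odd => //; rewrite opprD.
Qed.

Lemma altsumN m (g : 'I_m -> V) : altsum (fun i => - g i) = - altsum g.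
Proof.
by rewrite /altsum -sumrN; apply: eq_bigr => i _ /=; case: odd.
Qed.

Lemma altsum_unit m (k : 'I_m) (v : V) :
  altsum (fun i => if i == k then v else 0) = if odd k then - v else v.
Proof.
rewrite /altsum (bigD1 k) //= eqxx big1 ?addr0 // => i /negPf->.
by rewrite oppr0 if_same.
Qed.

Lemma altsum_const m (v : V) :
  altsum (fun _ : 'I_m => v) = if odd m then v else 0.
Proof.
rewrite /altsum; elim: m => [|m IH]; first by rewrite big_ord0.
by rewrite big_ord_recr /= IH; case: odd; rewrite ?subrr ?add0r.
Qed.

(** The analogue of the boundary of a boundary being zero: for [i <= j] the equal terms at [(i, j)]
    and [(j + 1, i)] carry opposite signs. *)
Lemma altsum_double m (D : 'I_m.+1 -> 'I_m -> V) :
  symmetric_family D -> altsum (fun i => altsum (D i)) = 0.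
Proof.
move=> symD; pose E (i : 'I_m.+1) (j : 'I_m) := if odd (i + j) then - D i j else D i j.
transitivity (\sum_(i < m.+1) \sum_(j < m) E i j).
  apply: eq_bigr => i _; rewrite /altsum /E.
  by case: ifP => oi; rewrite -?sumrN; apply: eq_bigr => j _;
    rewrite oddD oi; case: odd; rewrite ?opprK.
transitivity (\sum_(i < m.+1) (\sum_(j < m | (i <= j)%N) E i j +
                               \sum_(j < m | (j < i)%N) E i j)).
  apply: eq_bigr => i _; rewrite (bigID (fun j : 'I_m => (i <= j)%N)) /=.
  by congr (_ + _); apply: eq_bigl => j; rewrite ltnNge.
(* The last row has no [j] with [i <= j], and row 0 has none with [j < i]; without them both sums
   run over the same indices. *)
rewrite big_split big_ord_recr /= [X in _ + X + _]big1 ?addr0; last first.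
  by move=> j; rewrite leqNgt ltn_ord.
rewrite [X in _ + X]big_ord_recl [X in _ + (X + _)]big1 ?add0r //.
rewrite [X in _ + X](eq_bigr (fun i : 'I_m =>
  \sum_(j < m | (j <= i)%N) E (lift ord0 i) j)) //.
rewrite [X in _ + X](exchange_big_dep xpredT) //=.
rewrite -big_split big1 //= => i _; rewrite -big_split big1 //= => j ij.
have -> : E (lift ord0 j) i = - E (widen_ord (leqnSn m) i) j; last by rewrite subrr.
rewrite /E symD // lift0 addSn /= [(j + i)%N]addnC.
by case: odd; rewrite /= ?opprK.
Qed.

End AlternatingSums.

(** * Updated tuples and compatible tuples *)

Lemma upd_id k T (t : 'I_k -> T) i : upd t i (t i) = t.
Proof. by apply: funext => j; rewrite /upd; case: eqP => // ->. Qed.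

Lemma upd_same k T (t : 'I_k -> T) i x : upd t i x i = x.
Proof. by rewrite /upd eqxx. Qed.

Lemma upd_neq k T (t : 'I_k -> T) i j x : j != i -> upd t i x j = t j.
Proof. by rewrite /upd => /negPf->. Qed.

Lemma upd_upd k T (t : 'I_k -> T) i x y : upd (upd t i x) i y = upd t i y.
Proof. by apply: funext => j; rewrite /upd; case: eqP. Qed.

Section Compatible.
Context {n : nat} {H : structure n}.

Lemma compatibleP k (t : 'I_k.+1 -> psort H k) : (2 <= k)%N ->
  compatible t <-> forall i j : 'I_k, (i <= j)%N ->
     proj (t (lift ord0 j)) i = proj (t (widen_ord (leqnSn k) i)) j.
Proof.
move=> hk; split=> [[[k1 _]|[]//]|tP]; last by right.
by rewrite k1 in hk.
Qed.

Lemma compatible_eq_proj k (t t' : 'I_k.+1 -> psort H k) : (2 <= k)%N ->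
  (forall i, proj (t i) = proj (t' i)) -> compatible t -> compatible t'.
Proof.
move=> hk tt' /(compatibleP _ hk) ct; apply/(compatibleP _ hk) => i j ij.
by rewrite -!tt' ct.
Qed.

(** Compatibility equates each coordinate of the projection of the last entry with a coordinate of
    the projection of an earlier entry. *)
Lemma compatible_proj_last k (t t' : 'I_k.+1 -> psort H k) : (2 <= k)%N ->
  (forall i, i != ord_max -> t i = t' i) ->
  compatible t -> compatible t' -> proj (t ord_max) = proj (t' ord_max).
Proof.
case: k t t' => // k t t' hk tt' /(compatibleP _ hk) ct /(compatibleP _ hk) ct'.
have maxE : ord_max = lift ord0 ord_max :> 'I_k.+2 by apply: val_inj; rewrite /= /bump.
apply: funext => i.
have ik : (i <= @ord_max k)%N by rewrite -ltnS.
rewrite maxE ct // ct' // tt' //.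
by rewrite -val_eqE /= neq_ltn ltn_ord.
Qed.

End Compatible.

(** * Defects of compatible tuples and boundaries of families *)

Section Defect.
Context {n : nat} (hn : (2 <= n)%N) {H : structure n}.
Context (Hquasi : quasigroupoid H) (Hconn : connected H).
Local Open Scope ring_scope.
Context {V : zmodType} {act : V -> psort H n -> psort H n}.
Context (act0 : forall p, act 0 p = p).
Context (actD : forall u v p, act (u + v) p = act u (act v p)).
Context (act_proj : forall v p, proj (act v p) = proj p).
Context (act_trans : forall p q, proj p = proj q -> exists v, act v p = q).
Context (act_free : forall v p, act v p = p -> v = 0).
Context (act_qrel : forall v (p : 'I_n.+1 -> psort H n) (i : 'I_n), qrel H p ->
  qrel H (fun j => if (j == i :> nat) || (j == i.+1 :> nat)
                   then act v (p j) else p j)).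

Lemma act_inj p : injective (act^~ p).
Proof.
move=> u v uv; apply/subr0_eq/(@act_free _ p).
by rewrite addrC actD uv -actD addNr.
Qed.

(* A shift by [g] with vanishing alternating sum is a composite of moves
   shifting two consecutive entries: [h m] is what remains to be carried to
   position [m] once the entries before it are correct. *)
Lemma qrel_shift (t : 'I_n.+1 -> psort H n) (g : 'I_n.+1 -> V) :
  qrel H t -> altsum g = 0 -> qrel H (fun j => act (g j) (t j)).
Proof.
move=> Qt g0.
pose h := fix h m := if m is m'.+1 then g (inord m') - h m' else 0.
have step m : (m <= n)%N -> qrel H (fun j : 'I_n.+1 =>
    if (j < m)%N then act (g j) (t j) else
    if j == m :> nat then act (h m) (t j) else t j).
  elim: m => [|m IH] hm.
    by rewrite (_ : (fun _ => _) = t) // funeqE => j /=; rewrite act0 if_same.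
  have := @act_qrel (h m.+1) _ (Ordinal hm) (IH (ltnW hm)).
  rewrite (_ : (fun _ => _) = fun j : 'I_n.+1 =>
    if (j < m.+1)%N then act (g j) (t j) else
    if j == m.+1 :> nat then act (h m.+1) (t j) else t j) // funeqE => j /=.
  case: (ltngtP j m) => jm.
  - by rewrite ltnS ltnW // ltn_eqF // (leq_trans jm) // leqnSn.
  - rewrite ltnS leqNgt jm /=; case: eqP => //.
  - by rewrite jm ltnSn /= -actD -{1}jm inord_val subrK.
pose G j := if odd j then - g (inord j) else g (inord j).
(* Up to sign [h m] is the alternating sum of the first [m] shifts, so the vanishing of the full sum
   makes [h n] the shift wanted at position [n]. *)
have hE m : (if odd m then - h m else h m) = - \sum_(0 <= j < m) G j.
  elim: m => [|m IH]; first by rewrite big_nil oppr0.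
  rewrite big_nat_recr // [RHS]opprD -IH {1}/h -/h /G /=.
  by case: odd; rewrite /= ?opprB ?opprK // addrC.
have := step n (leqnn n); congr qrel; apply: funext => j.
have : (j <= n)%N by rewrite -ltnS.
rewrite leq_eqVlt => /orP[/eqP jn|->//].
rewrite jn ltnn eqxx; congr act.
have jE : j = ord_max by apply: val_inj.
have /eqP : G n + \sum_(0 <= j < n) G j = 0.
  rewrite addrC -big_nat_recr // big_mkord -[RHS]g0.
  by apply: eq_bigr => i _; rewrite /G inord_val.
rewrite addr_eq0 -hE /G jE (_ : inord n = ord_max); last first.
  by apply: val_inj; rewrite /= inordK.
by case: odd => /eqP // /oppr_inj.
Qed.

(** On compatible tuples the default 0 is never taken, by [qrel_defect]. *)
Definition defect (t : 'I_n.+1 -> psort H n) : V :=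
  xget 0 [set v | qrel H (upd t ord_max (act v (t ord_max)))]%classic.

Lemma qrel_xdefect t v : qrel H (upd t ord_max (act v (t ord_max))) ->
  qrel H (upd t ord_max (act (defect t) (t ord_max))).
Proof.
move=> Qv.
apply: (@xgetPex _ 0 [set v | qrel H (upd t ord_max (act v (t ord_max)))]%classic).
by exists v.
Qed.

(** Connectedness provides a last entry [x] completing [t] to a Q-tuple. Both tuples are compatible,
    so [x] lies in the fiber of the old last entry, where the action is transitive. *)
Lemma qrel_defect t :
  compatible t -> qrel H (upd t ord_max (act (defect t) (t ord_max))).
Proof.
move=> ct; have [x Qx] := Hconn.2 t ct ord_max.
have [_ /(_ _ Qx) cx _] := Hquasi.
have [v vx] : exists v, act v (t ord_max) = x.
  apply: act_trans.
  have tx i : i != ord_max -> t i = upd t ord_max x i by move=> imax; rewrite upd_neq.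
  by have := compatible_proj_last hn tx ct cx; rewrite upd_same.
by rewrite -vx in Qx; apply: qrel_xdefect Qx.
Qed.

Lemma defect_eq t v : qrel H (upd t ord_max (act v (t ord_max))) -> defect t = v.
Proof.
move=> Qv; have Qd : qrel H (upd t ord_max (act (defect t) (t ord_max))).
  exact: qrel_xdefect Qv.
have [_ _ /(_ _ Qv ord_max)[_ /(_ (act (defect t) (t ord_max)))]] := Hquasi.
by rewrite upd_same upd_upd => /(_ Qd)/act_inj.
Qed.

Lemma qrelP t v : compatible t ->
  qrel H (upd t ord_max (act v (t ord_max))) <-> defect t = v.
Proof. by move=> ct; split=> [/defect_eq//|<-]; apply: qrel_defect. Qed.

(** Shift the Q-tuple completed by the defect along [g], less a correction [s] at the last position
    that makes the alternating sum vanish. Position [n] carries the sign of [n], whence the case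
    distinction. *)
Lemma defect_shift t g : compatible t ->
  defect (fun j => act (g j) (t j)) =
  defect t - (if odd n then - altsum g else altsum g).
Proof.
move=> ct; apply: defect_eq; set d := defect t; set s := if _ then _ else _.
have := qrel_shift (g := fun j => g j - (if j == ord_max then s else 0))
  (qrel_defect ct).
rewrite altsumD altsumN altsum_unit /= {1}/s.
have -> : (if odd n then - s else s) = altsum g.
  by rewrite /s; case: odd; rewrite ?opprK.
rewrite subrr => /(_ erefl); congr qrel; apply: funext => j.
rewrite /upd -/d; case: eqP => [->|_]; last by rewrite subr0.
by rewrite -!actD; congr act; rewrite addrAC [g _ + d]addrC addrAC.
Qed.

Definition boundary (p : 'I_n.+2 -> 'I_n.+1 -> psort H n) : V :=
  altsum (fun i => defect (p i)).

(** The boundary changes, up to sign, by the double alternating sum of [g], which is 0. Hence only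
    the projections of the entries matter, as long as the shift respects the shared faces. *)
Lemma boundary_shift p g : (forall i, compatible (p i)) -> symmetric_family g ->
  boundary (fun i j => act (g i j) (p i j)) = boundary p.
Proof.
move=> cp sg; rewrite /boundary.
rewrite (_ : (fun i => _) = fun i => defect (p i) +
    - (if odd n then - altsum (g i) else altsum (g i))); last first.
  by apply: funext => i; apply: defect_shift.
rewrite altsumD altsumN; case: odd; rewrite ?altsumN altsum_double //.
  by rewrite !oppr0 addr0.
by rewrite subr0.
Qed.

(** The two alternating sums agree in every term but the one at [l], hence also there. *)
Lemma boundary_associative (c : V) :
  (forall p, (forall i, compatible (p i)) -> symmetric_family p ->
     boundary p = altsum (fun _ : 'I_n.+2 => c)) ->
  forall p, (forall i, compatible (p i)) -> symmetric_family p ->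
    forall l, (forall i, i != l -> defect (p i) = c) -> defect (p l) = c.
Proof.
move=> bE p cp sp l pc; have := bE p cp sp.
rewrite /boundary /altsum (bigD1 l) // [in RHS](bigD1 l) //=.
rewrite (eq_bigr (fun i : 'I_n.+2 => if odd i then - c else c)).
  by move=> /addIr; case: odd => // /oppr_inj.
by move=> i /pc->.
Qed.

End Defect.

(** * Maximal compatible systems obtained from choices of fillings *)

Section Systems.
Context {n : nat} {H : structure n}.

(* Unlike [lies_over], this makes sense for k = 1. *)
Fixpoint lies_above (k : nat) : psort H k -> ('I_k -> psort H 1) -> Prop :=
  match k return psort H k -> ('I_k -> psort H 1) -> Prop with
  | k'.+1 =>
    match k' as m
      return (psort H m -> ('I_m -> psort H 1) -> Prop) ->
             psort H m.+1 -> ('I_m.+1 -> psort H 1) -> Prop with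
    | 0 => fun _ f w => f = w ord0
    | _ => fun over_k' f w =>
             forall j, over_k' (proj f j) (fun i => w (lift j i))
    end (@lies_above k')
  | 0 => fun _ _ => False
  end.

Lemma lies_above_lies_over k (f : psort H k) w : (2 <= k)%N ->
  lies_above f w <-> lies_over f w.
Proof.
case: k f w => // -[] // k f w _; elim: k f w => [|k IH] f w; last first.
  by split=> fw j; [apply: (IH _ _).1 (fw j)|apply: (IH _ _).2 (fw j)].
have l0 : lift ord0 ord0 = ord_max :> 'I_2 by apply: val_inj.
have l1 : lift ord_max ord0 = ord0 :> 'I_2 by apply: val_inj.
split=> [fw|[f0 f1] j /=]; first by split; rewrite [LHS]fw ?l0 ?l1.
have [->|->] : j = ord0 \/ j = ord_max; last by rewrite l1.
  by case: j => -[|[|//]] ?; [left|right]; apply: val_inj.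
by rewrite l0.
Qed.

Lemma lies_above_proj k (f : psort H k) w (j : 'I_k) : (2 <= k)%N ->
  lies_above f w -> lies_above (proj f j) (fun i => w (lift j i)).
Proof. by case: k f w j => // -[]// k f w j _; apply. Qed.

Lemma lies_above_eq_proj k (f f' : psort H k) w : (2 <= k)%N ->
  proj f = proj f' -> lies_above f w -> lies_above f' w.
Proof. by case: k f f' w => // -[]// k f f' w _ /= ->. Qed.

(** One such choice yields a maximal compatible system on every vertex set simultaneously, by
    [hereditary_maximal]. *)
Definition fiber_section (C : forall k, set (psort H k)) : Prop :=
  (forall k (f : psort H k), exists2 f', C k f' & proj f' = proj f) /\
  (forall k (f f' : psort H k), C k f -> C k f' -> proj f = proj f' -> f = f').

(** Choose a representative of each fiber, taken from [F] whenever [F] meets the fiber. Injectivity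
    of the projection on [F] leaves no other candidate there, so all of [F] gets chosen. *)
Lemma exists_fiber_section (F : forall k, set (psort H k)) :
  (forall k (f f' : psort H k), F k f -> F k f' -> proj f = proj f' -> f = f') ->
  exists2 C, fiber_section C & forall k f, F k f -> C k f.
Proof.
move=> Finj.
pose R k t (f : psort H k) :=
  proj f = t /\ ((exists2 f', F k f' & proj f' = t) -> F k f).
have Rex k (f : psort H k) : exists f', R k (proj f) f'.
  have [[f' Ff' ff']|nF] := pselect (exists2 f', F k f' & proj f' = proj f).
    by exists f'.
  by exists f.
(* The representative depends only on the projection, not on the element witnessing that the fiber
   is inhabited. *)
have irr k t t' (e : exists f, R k t f) (e' : exists f, R k t' f) : t = t' ->
    projT1 (cid e) = projT1 (cid e').
  by move=> tt'; subst t'; rewrite (Prop_irrelevance e e').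
exists (fun k f => f = projT1 (cid (Rex k f))); first split.
- move=> k f; exists (projT1 (cid (Rex k f))); last by case: cid => f' [].
  by apply: irr; case: cid => f' [].
- by move=> k f f' fE f'E ff'; rewrite fE f'E; apply: irr.
move=> k f Ff; case: cid => f' /= [pf' Ff'].
by apply: Finj => //; apply: Ff'; exists f.
Qed.

Fixpoint hereditary (C : forall k, set (psort H k)) (X : set (psort H 1)) (k : nat) :
    psort H k -> Prop :=
  match k return psort H k -> Prop with
  | k'.+1 =>
    match k' as m return (psort H m -> Prop) -> psort H m.+1 -> Prop with
    | 0 => fun _ f => X f
    | m.+1 => fun her_k' f => C m.+2 f /\ forall j, her_k' (proj f j)
    end (@hereditary C X k')
  | 0 => fun _ => False
  end.

Lemma hereditary_mono C (X Y : set (psort H 1)) k (f : psort H k) :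
  (forall x, X x -> Y x) -> hereditary C X f -> hereditary C Y f.
Proof.
move=> XY; case: k f => // k; elim: k => [|k IH] f; first exact: XY.
by case=> Cf pf; split=> // j; apply: IH (pf j).
Qed.

Lemma hereditary_proj C X k (f : psort H k) (j : 'I_k) : (2 <= k)%N ->
  hereditary C X f -> hereditary C X (proj f j).
Proof. by case: k f j => // -[]// k f j _ [_]; apply. Qed.

Context (Hconn : connected H).
Context (C : forall k, set (psort H k)) (HC : fiber_section C).

(** By induction the projections agree, and [C] has only one element in each fiber. *)
Lemma hereditary_unique X k (f f' : psort H k) w :
  hereditary C X f -> hereditary C X f' -> lies_above f w -> lies_above f' w -> f = f'.
Proof.
case: k f f' w => // k; elim: k => [|k IH] f f' w; first by move=> _ _ -> ->.
case=> Cf pf [Cf' pf'] fw f'w; apply: HC.2 => //.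
by apply: funext => j; apply: (IH _ _ _ (pf j) (pf' j) (fw j) (f'w j)).
Qed.

(** The two sides of each compatibility identity are hereditary and lie above the same points, by
    [lift_lift], so they coincide. For [k = 1] injectivity of [w] is what is asked. *)
Lemma hereditary_compatible X k (t : 'I_k.+1 -> psort H k) w :
  (0 < k)%N -> injective w -> (forall j, hereditary C X (t j)) ->
  (forall j, lies_above (t j) (fun i => w (lift j i))) -> compatible t.
Proof.
case: k t w => // -[|k] t w _ w_inj tX tw.
  left; split=> //; rewrite [t ord0]tw [t ord_max]tw => /w_inj.
  by move/(congr1 val).
apply/compatibleP => // i j ij.
apply: (@hereditary_unique X) (fun x => w (lift (lift ord0 j) (lift i x))) _ _ _ _.
- by have [_] := tX (lift ord0 j); apply.
- by have [_] := tX (widen_ord (leqnSn k.+2) i); apply.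
- exact: tw.
- have := tw (widen_ord (leqnSn k.+2) i) j.
  by congr lies_above; apply: funext => x; rewrite lift_lift.
Qed.

(** The fillings over the facets of [w] form a compatible tuple; connectedness puts an element over
    it, which is then replaced by the member of [C] in the same fiber. *)
Lemma hereditary_exists (X : set (psort H 1)) k (w : 'I_k -> psort H 1) :
  (0 < k <= n)%N -> injective w -> (forall i, X (w i)) ->
  exists f : psort H k, hereditary C X f /\ lies_above f w.
Proof.
case: k w => // k; elim: k => [|k IH] w kn w_inj wX.
  by exists (w ord0); split=> //; apply: wX.
have /choice[t tP] (j : 'I_k.+2) : exists f : psort H k.+1,
    hereditary C X f /\ lies_above f (fun i => w (lift j i)).
  apply: IH => //; first exact: ltnW kn.
  by move=> x y /w_inj/lift_inj.
have [|f0 f0t] := Hconn.1 k.+1 t kn.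
  by apply: (@hereditary_compatible X _ _ w) => // j; have [] := tP j.
have [f Cf ff0] := HC.1 _ f0.
exists f; split=> [|j]; last by rewrite ff0 f0t; have [] := tP j.
by split=> // j; rewrite ff0 f0t; have [] := tP j.
Qed.

Lemma hereditary_maximal X : maximal_compatible_system (hereditary C X).
Proof.
split; first by case=> // k a j _ _ [_]; apply.
move=> k w /andP[k2 kn] w_inj wX.
have [|f [fX fw]] := @hereditary_exists X k w _ w_inj wX.
  by rewrite (leq_trans _ k2) //= (leq_trans kn) // leq_pred.
exists f; split=> [|f' [f'X]]; first by split=> //; apply/lies_above_lies_over.
by move/lies_above_lies_over => /(_ k2) f'w; apply: hereditary_unique fX f'X fw f'w.
Qed.

End Systems.

Lemma exists_filling n (H : structure n) k : connected H -> (0 < k <= n)%N ->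
  (exists w : 'I_k -> psort H 1, injective w) ->
  exists2 C, fiber_section C &
    exists s : ('I_k -> psort H 1) -> psort H k, forall w, injective w ->
      hereditary C [set: psort H 1]%classic (s w) /\ lies_above (s w) w.
Proof.
move=> Hconn kn [w0 w0_inj].
have [//|C HC _] := @exists_fiber_section n H (fun _ _ => False).
have her w (w_inj : injective w) : exists f : psort H k,
    hereditary C [set: psort H 1]%classic f /\ lies_above f w.
  exact: (hereditary_exists Hconn HC kn w_inj).
(* [f0] is the default value of [s] at tuples with repetitions. *)
have [f0 _] := her _ w0_inj; exists C => //.
have /choice[s sP] (w : 'I_k -> psort H 1) : exists f, injective w ->
    hereditary C [set: psort H 1]%classic f /\ lies_above f w; last by exists s.
have [w_inj|nw] := pselect (injective w); last by exists f0.
by have [f fw] := her _ w_inj; exists f.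
Qed.

(** * Positions of vertices in finite vertex sets *)

Section Index.
Context {m : nat}.
Implicit Types (S : {set 'I_m}) (x y : 'I_m).

(** The position, counted from 0, of [x] in the increasing enumeration of [S], or of [x |: S] when
    [x] is outside [S]. *)
Definition index_in x S : nat := #|[set y in S | (y < x)%N]|.

Lemma index_in_setU1 x y S : x \notin S ->
  index_in y (x |: S) = ((x < y) + index_in y S)%N.
Proof.
move=> xS; rewrite /index_in; case: ltnP => xy.
  rewrite (_ : [set z in x |: S | _] = x |: [set z in S | (z < y)%N]).
    by rewrite cardsU1 inE (negPf xS).
  by apply/setP => z; rewrite !inE; case: eqP => // ->; rewrite xy.
apply: eq_card => z; rewrite !inE.
by case: eqP => // ->; rewrite ltnNge xy /= !andbF.
Qed.

Lemma index_in_le x y S : (x <= y)%N -> (index_in x S <= index_in y S)%N.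
Proof.
move=> xy; apply/subset_leq_card/subsetP => z; rewrite !inE.
by case/andP=> -> /leq_trans; apply.
Qed.

Lemma index_in_lt x y S : x \in S -> (x < y)%N -> (index_in x S < index_in y S)%N.
Proof.
move=> xS xy; apply/proper_card/properP; split.
  apply/subsetP => z; rewrite !inE => /andP[-> zx] /=.
  exact: ltn_trans zx xy.
by exists x; rewrite !inE xS ?xy ?ltnn.
Qed.

Lemma index_in_inj S : {in S &, injective (index_in^~ S)}.
Proof.
move=> x y xS yS xy; apply: val_inj => /=.
by case: (ltngtP x y) => // lt; [have := index_in_lt xS lt|have := index_in_lt yS lt];
  rewrite [index_in x S]xy ltnn.
Qed.

Lemma index_in_bound x S : x \in S -> (index_in x S < #|S|)%N.
Proof.
move=> xS; apply/proper_card/properP; split.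
  by apply/subsetP => z; rewrite !inE => /andP[].
by exists x; rewrite // !inE ltnn andbF.
Qed.

Lemma index_in_surj k S (i : 'I_k.+1) : #|S| = k.+1 ->
  exists2 x, x \in S & index_in x S = i.
Proof.
move=> Sk; pose f x : 'I_k.+1 := inord (index_in x S).
have fE x : x \in S -> f x = index_in x S :> nat.
  by move=> xS; rewrite inordK // -Sk index_in_bound.
have : i \in f @: S.
  have -> : f @: S = [set: 'I_k.+1].
    apply/eqP; rewrite eqEcard subsetT cardsT card_ord card_in_imset ?Sk ?leqnn //.
    by move=> x y xS yS /(congr1 val) /=; rewrite !fE // => /index_in_inj; apply.
  by rewrite inE.
by case/imsetP => x xS ->; exists x; rewrite // fE.
Qed.

Lemma index_in_enum k (e : 'I_k -> 'I_m) (j : 'I_k) :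
  {homo e : x y / (x < y)%N} -> index_in (e j) (e @: [set: 'I_k]) = j.
Proof.
move=> e_mono.
have lt_e (x y : 'I_k) : (e x < e y)%N = (x < y)%N.
  case: (ltngtP x y) => [/e_mono->//|/e_mono|/val_inj->]; last by rewrite ltnn.
  by case: (ltngtP (e x) (e y)).
have e_inj : injective e.
  move=> x y exy; apply: val_inj => /=.
  by case: (ltngtP x y) => // /e_mono; rewrite exy ltnn.
rewrite /index_in (_ : finset _ = e @: [set x : 'I_k | (x < j)%N]).
  rewrite card_imset // -sum1dep_card (big_ord_narrow (ltnW (ltn_ord j))).
  by rewrite sum1_card card_ord.
apply/setP => y; rewrite inE; apply/andP/imsetP => [[/imsetP[x _ ->]]|[x]].
  by rewrite lt_e => xj; exists x; rewrite ?inE.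
by rewrite inE => xj ->; rewrite lt_e xj imset_f.
Qed.

End Index.

Lemma setC_eq2 m (S : {set 'I_m.+2}) : #|S| = m ->
  exists l j, S = ~: [set l; lift l j].
Proof.
move=> Sm; have /cards2P[l [x [lx SE]]] : #|~: S| == 2.
  by rewrite cardsCs setCK Sm card_ord !subSn // subnn.
have [j jE _] := unlift_some lx.
by exists l, j; rewrite -jE -SE setCK.
Qed.

(** The two equations say that [(l, j)] and [(l', j')] describe the same pair of omitted vertices in
    the two possible orders. *)
Lemma symmetric_family_swap m T (p : 'I_m.+1 -> 'I_m -> T) l j l' j' :
  symmetric_family p -> l' = lift l j -> l = lift l' j' -> p l j = p l' j'.
Proof.
move=> sp; wlog ll' : l j l' j' / (l < l')%N => [wl lj lj'|].
  case: (ltngtP l l') => ll'; first exact: wl.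
    by apply/esym/wl.
  by have := neq_lift l j; rewrite -lj (val_inj ll') eqxx.
move=> /(congr1 val) /= lE /(congr1 val) /= lE'.
have lj : (l <= j)%N by move: lE ll'; rewrite /bump; case: leqP => /= *; lia.
have j'E : l = j' :> nat by move: lE' ll'; rewrite /bump; case: leqP => /= *; lia.
have j'j : (j' <= j)%N by rewrite -j'E.
have := sp _ _ j'j; congr (p _ _ = p _ _); apply: val_inj => //=.
by rewrite lE /bump lj.
Qed.

(** * Faces of the boundary of a simplex *)

Section Faces.
Context {n : nat} (hn : (2 <= n)%N) {H : structure n}.
Context (Hquasi : quasigroupoid H).
Context {p : 'I_n.+2 -> 'I_n.+1 -> psort H n}.
Context (compatible_p : forall i, compatible (p i)) (sym_p : symmetric_family p).

(* [face k S f]: [f] is the face with vertex set [S] of the boundary of the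
   (n+1)-simplex formed by the n-simplices [p l j], where [p l j] is the one
   missing the vertices [l] and [lift l j]. *)
Inductive face : forall k, {set 'I_n.+2} -> psort H k -> Prop :=
| face_top l j : face (~: [set l; lift l j]) (p l j)
| face_proj k (S : {set 'I_n.+2}) (g : psort H k.+1) (x : 'I_n.+2)
    (j : 'I_k.+1) : (0 < k)%N -> x \notin S ->
    j = index_in x S :> nat -> face (x |: S) g -> face S (proj g j).

Lemma face_card k (S : {set 'I_n.+2}) (f : psort H k) : face S f -> #|S| = k.
Proof.
elim=> {k S f} [l j|k S g x j _ xS _ _]; last first.
  by rewrite cardsU1 xS => -[].
have := cardsC [set l; lift l j]; rewrite card_ord cards2 neq_lift /=.
by case.
Qed.

Lemma face_bound k (S : {set 'I_n.+2}) (f : psort H k) : face S f -> (0 < k <= n)%N.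
Proof.
elim=> {k S f} [l j|k S g x j k0 _ _ _ /andP[_ /ltnW ->]].
  by rewrite leqnn (leq_trans _ hn).
by rewrite k0.
Qed.

(** Inversion with the equation between sorts kept explicit; [eq_irrelevance] on [nat] then removes
    the transport in the two cases below. *)
Lemma face_inv k (S : {set 'I_n.+2}) (f : psort H k) : face S f ->
  (exists (e : n = k) l j, S = ~: [set l; lift l j] /\
     f = eq_rect n (psort H) (p l j) k e) \/
  (exists (g : psort H k.-1.+2) x (j : 'I_k.-1.+2) (e : k.-1.+1 = k),
    [/\ x \notin S, j = index_in x S :> nat, face (x |: S) g &
        f = eq_rect k.-1.+1 (psort H) (proj g j) k e]).
Proof.
case=> {k S f} [l j|[]// k S g x j _ xS jE fg].
  by left; exists erefl, l, j.
by right; exists g, x, j, erefl.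
Qed.

Lemma face_inv_top (S : {set 'I_n.+2}) (f : psort H n) : face S f ->
  exists l j, S = ~: [set l; lift l j] /\ f = p l j.
Proof.
case/face_inv => [[e [l [j [SE fE]]]]|[g [x [j [e [_ _ /face_bound]]]]]].
  by exists l, j; split=> //; rewrite fE (eq_irrelevance e erefl).
by move=> /andP[_ lt] _; move: lt; rewrite e ltnn.
Qed.

Lemma face_inv_proj k (S : {set 'I_n.+2}) (f : psort H k) : (k < n)%N -> face S f ->
  exists (g : psort H k.+1) x (j : 'I_k.+1),
    [/\ x \notin S, j = index_in x S :> nat, face (x |: S) g & f = proj g j].
Proof.
move=> kn ff; have /andP[k0 _] := face_bound ff.
case: k k0 f kn ff => // k _ f kn /face_inv[[e]|[g [x [j [e [xS jE fg fE]]]]]].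
  by move=> _; exfalso; move: kn; rewrite -e ltnn.
by exists g, x, j; split=> //; rewrite fE (eq_irrelevance e erefl).
Qed.

Lemma face_setD1 k (S : {set 'I_n.+2}) (f : psort H k.+2) x (i : 'I_k.+2) :
  face S f -> x \in S -> index_in x S = i -> face (S :\ x) (proj f i).
Proof.
move=> ff xS xi; have xS' : x \notin S :\ x by rewrite !inE eqxx.
apply: (face_proj _ xS') => //; rewrite ?setD1K //.
by rewrite -xi -{1}(setD1K xS) index_in_setU1 // ltnn.
Qed.

Lemma face_closed k (S : {set 'I_n.+2}) (f : psort H k.+2) (i : 'I_k.+2) :
  face S f -> exists S', face S' (proj f i).
Proof.
move=> ff; have [x xS xi] := index_in_surj i (face_card ff).
by exists (S :\ x); apply: face_setD1.
Qed.

(** Downward induction on [k]: add a vertex, take a face there, and project the vertex away. *)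
Lemma face_exists k (S : {set 'I_n.+2}) : (0 < k <= n)%N -> #|S| = k ->
  exists f : psort H k, face S f.
Proof.
move=> /andP[k0 kn]; move: {-1}(n - k)%N (erefl (n - k)%N) => d.
elim: d k k0 kn S => [|d IH] k k0 kn S nk Sk.
  have kE : k = n by apply/eqP; rewrite eqn_leq kn -subn_eq0 nk.
  rewrite kE in Sk *; have [l [j ->]] := setC_eq2 Sk.
  by exists (p l j); apply: face_top.
have kn' : (k < n)%N by rewrite -subn_gt0 nk.
have [x xS] : exists x, x \in ~: S.
  by apply/card_gt0P; rewrite cardsCs setCK card_ord Sk subn_gt0 ltnS ltnW.
rewrite inE in xS.
have [||||g fg] := IH k.+1 _ _ (x |: S) _ _ => //.
- by rewrite subnS nk.
- by rewrite cardsU1 xS Sk.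
have xlt : (index_in x S < k.+1)%N.
  by rewrite ltnS -Sk; apply/subset_leq_card/subsetP => y; rewrite !inE => /andP[].
by exists (proj g (Ordinal xlt)); apply: face_proj fg.
Qed.

(** The shell of [U] is the projection tuple of a face on [U] when [k < n], and a row of [p] when
    [k = n], the row being that of the only vertex outside [U]. Its compatibility drives
    [face_unique]. *)
Lemma shell_exists k (U : {set 'I_n.+2}) : (0 < k <= n)%N -> #|U| = k.+1 ->
  exists t : 'I_k.+1 -> psort H k, compatible t /\
    forall (x : 'I_n.+2) (S : {set 'I_n.+2}) (j : 'I_k.+1), x \notin S -> x |: S = U ->
      j = index_in x S :> nat -> face S (t j).
Proof.
move=> /andP[k0]; rewrite leq_eqVlt => /orP[/eqP kn|kn] Uk; last first.
  have [g fg] := @face_exists k.+1 U kn Uk; exists (proj g); split.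
    by have [cg _ _] := Hquasi; apply: cg; rewrite k0.
  by move=> x S j xS SU jE; apply: face_proj (jE) _ => //; rewrite SU.
subst k; have /eqP/cards1P[l lE] : #|~: U| = 1%N.
  by rewrite cardsCs setCK card_ord Uk subSnn.
exists (p l); split=> // x S j xS SU jE.
have xl : l != x.
  apply/eqP => xl; have := set11 l; rewrite -lE inE -SU !inE xl eqxx //.
have [i xE _] := unlift_some xl.
have SE : S = ~: [set l; x].
  apply/setP => z; have /setP/(_ z) := lE; rewrite -SU !inE.
  case: (eqVneq z x) => [->|_] /=; first by rewrite (negPf xS) orbT.
  by case: (z \in S); case: (z == l).
suff -> : j = i by rewrite SE xE; apply: face_top.
apply: val_inj; rewrite /= jE.
(* [lift l] enumerates [U] increasingly, so [x], being [lift l i], has position [i]. *)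
have -> : index_in x S = index_in (lift l i) (lift l @: [set: 'I_n.+1]).
  have -> : lift l @: [set: 'I_n.+1] = x |: S.
    apply/setP => z; rewrite SU -[U]setCK lE !inE; apply/imsetP/idP => [[y _ ->]|].
      by rewrite eq_sym neq_lift.
    by rewrite eq_sym => /unlift_some[y -> _]; exists y.
  by rewrite -xE index_in_setU1 // ltnn.
by apply: index_in_enum => y z; apply: ltn_lift.
Qed.

(** Downward induction on [k]. For [k = n] this is the symmetry of [p]. Below, the two faces are
    projections from [x |: S] and [x' |: S]; if [x] and [x'] differ, both larger faces belong to the
    shell of [U], and a compatibility identity of that shell equates the projections. *)
Lemma face_unique k (S : {set 'I_n.+2}) (f f' : psort H k) :
  face S f -> face S f' -> f = f'.
Proof.
move=> ff; have /andP[k0 kn] := face_bound ff; move: ff.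
move: {-1}(n - k)%N (erefl (n - k)%N) => d.
elim: d k k0 kn S f f' => [|d IH] k k0 kn S f f' nk.
  have kE : k = n by apply/eqP; rewrite eqn_leq kn -subn_eq0 nk.
  subst k => /face_inv_top[l [j [SE ->]]] /face_inv_top[l' [j' [SE' ->]]].
  have lE : [set l; lift l j] = [set l'; lift l' j'].
    by apply: setC_inj; rewrite -SE -SE'.
  have [ll'|ll'] := eqVneq l l'.
    rewrite -ll' in lE *; congr p; apply: (@lift_inj _ l).
    have := set22 l (lift l j); rewrite lE !inE eq_sym (negPf (neq_lift _ _)).
    by move/eqP.
  apply: symmetric_family_swap => //.
    have := set21 l' (lift l' j'); rewrite -lE !inE eq_sym (negPf ll') /=.
    by move/eqP.
  have := set21 l (lift l j); rewrite lE !inE (negPf ll') /=.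
  by move/eqP.
have kn' : (k < n)%N by rewrite -subn_gt0 nk.
have nk' : (n - k.+1)%N = d by rewrite subnS nk.
move=> /(face_inv_proj kn')[g [x [j [xS jE fg ->]]]].
move=> /(face_inv_proj kn')[g' [x' [j' [xS' jE' fg' ->]]]] {f f'}.
wlog xx' : x x' j j' g g' xS xS' jE jE' fg fg' / (x <= x')%N => [wl|].
  by case: (leqP x x') => [/wl|/ltnW/wl] wlE; [exact: wlE|apply/esym/wlE].
have [xE|xE] := eqVneq x x'.
  subst x'; rewrite (IH _ _ _ _ g g' nk' fg fg') //.
  by have -> : j = j' by apply: val_inj; rewrite /= jE jE'.
have {}xx' : (x < x')%N by rewrite ltn_neqAle xx' andbT.
pose U := x |: (x' |: S).
have xU : x \notin x' |: S by rewrite !inE negb_or xE.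
have xU' : x' \notin x |: S by rewrite !inE negb_or eq_sym xE.
have Uk : #|U| = k.+2.
  by rewrite cardsU1 xU cardsU1 xS' (face_card (face_proj k0 xS jE fg)).
have [|t [ct tU]] := @shell_exists k.+1 U _ Uk; first by rewrite kn'.
have -> : g = t (lift ord0 j').
  apply: (IH _ _ _ _ _ _ nk' fg) => //; apply: tU xU' _ _.
    by rewrite /U setUCA.
  by rewrite index_in_setU1 // xx' lift0 jE'.
have -> : g' = t (widen_ord (leqnSn k.+1) j).
  apply: (IH _ _ _ _ _ _ nk' fg') => //; apply: tU xU _ _ => //.
  by rewrite index_in_setU1 // ltnNge ltnW //= jE.
move/compatibleP: ct; apply; first by rewrite ltnS.
by rewrite jE jE' index_in_le // ltnW.
Qed.

(** An edge joining [x] to [y] would have equal end points, against compatibility for [k = 1]. *)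
Lemma vertex_inj x y (f : psort H 1) : face [set x] f -> face [set y] f -> x = y.
Proof.
wlog xy : x y / (x < y)%N => [wl fx fy|fx fy].
  case: (ltngtP x y) => [xy|xy|/val_inj//]; first exact: wl.
  exact/esym/wl.
have xy' : x != y by rewrite -val_eqE ltn_eqF.
have [||g fg] := @face_exists 2 [set x; y] => //; first by rewrite cards2 xy'.
have [cg _ _] := Hquasi; have [[_ neq]|[]//] := cg 1%N g hn; case: neq.
transitivity f.
  apply: (@face_unique 1 [set y]) => //; apply: face_proj fg => //.
    by rewrite inE.
  by apply/esym/eqP; rewrite cards_eq0 -subset0; apply/subsetP => z;
    rewrite !inE; case: eqP => // ->; rewrite ltnNge ltnW.
apply: (@face_unique 1 [set x]) => //; rewrite setUC in fg.
apply: face_proj fg => //; first by rewrite inE eq_sym.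
by apply/esym/eqP/cards1P; exists x; apply/setP => z; rewrite !inE; case: eqP => // ->.
Qed.

(** A vertex [z] of [T] survives in the projection dropping another vertex [x]. That projection is
    shared with the second face and by induction determines its own vertex set, so [z] lies in
    [T']. *)
Lemma face_eq_proj k (S S' : {set 'I_n.+2}) (f f' : psort H k) : (2 <= k)%N ->
  face S f -> face S' f' -> proj f = proj f' -> S = S'.
Proof.
have subS m (T T' : {set 'I_n.+2}) (g g' : psort H m.+2) :
    (forall (R R' : {set 'I_n.+2}) (h : psort H m.+1), face R h -> face R' h -> R = R') ->
    face T g -> face T' g' -> proj g = proj g' -> T = T'.
  move=> IH fg fg' gg'; apply/eqP; rewrite eqEcard (face_card fg) (face_card fg') leqnn andbT.
  apply/subsetP => z zT.
  have [x] : exists x, x \in T :\ z.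
    by apply/card_gt0P; have := cardsD1 z T; rewrite zT (face_card fg) add1n => -[<-].
  rewrite !inE => /andP[xz xT].
  have ilt : (index_in x T < m.+2)%N by rewrite -(face_card fg) index_in_bound.
  have [x' xT' iE'] := index_in_surj (Ordinal ilt) (face_card fg').
  have fx := face_setD1 (i := Ordinal ilt) fg xT erefl.
  have fx' := face_setD1 fg' xT' iE'.
  rewrite gg' in fx; have /setP/(_ z) := IH _ _ _ fx fx'.
  by rewrite !inE eq_sym xz zT => /esym/andP[].
case: k f f' => // -[] // k f f' _; apply: (@subS k) => {S S' f f'}.
elim: k => [|k IH] S S' f ff ff'; last exact: (subS _ _ _ f f).
have /eqP/cards1P[x SE] := face_card ff; have /eqP/cards1P[x' SE'] := face_card ff'.
by rewrite SE SE' (@vertex_inj x x' f) // -?SE -?SE'.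
Qed.

(** [a] lists the faces on single vertices. The map [e] has to be increasing because [face] numbers
    projections by the order of the vertices. *)
Lemma vertices_exist : exists2 a : 'I_n.+2 -> psort H 1, injective a &
  forall k (e : 'I_k -> 'I_n.+2) (f : psort H k), (0 < k)%N ->
    {homo e : x y / (x < y)%N} -> face (e @: [set: 'I_k]) f ->
    lies_above f (fun i => a (e i)).
Proof.
have /choice[a aP] (x : 'I_n.+2) : exists f : psort H 1, face [set x] f.
  by apply: face_exists; rewrite ?cards1 //= ltnW.
exists a => [x y axy|]; first by apply: (@vertex_inj _ _ (a x)); rewrite // axy.
case=> // k e f _; elim: k e f => [|k IH] e f e_mono ff.
  apply: (face_unique ff); rewrite (_ : e @: _ = [set e ord0]) //.
  by apply/setP => z; rewrite inE; apply/imsetP/eqP => [[i _ ->]|->];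
    [rewrite ord1|exists ord0].
have e_inj : injective e.
  move=> x y exy; apply: val_inj => /=.
  by case: (ltngtP x y) => // /e_mono; rewrite exy ltnn.
move=> j; apply: (IH (fun i => e (lift j i))).
  move=> x y xy; exact/e_mono/ltn_lift.
set S := _ @: _; have xS : e j \notin S.
  by apply/imsetP => -[i _ /e_inj/eqP]; rewrite (negPf (neq_lift _ _)).
have eE : e j |: S = e @: [set: 'I_k.+2].
  apply/setP => z; rewrite !inE; apply/orP/imsetP => [[/eqP->|/imsetP[i _ ->]]|[i _ ->]].
  - by exists j.
  - by exists (lift j i).
  case: (unliftP j i) => [i' ->|->]; last by left.
  by right; apply/imsetP; exists i'.
apply: (face_proj _ xS) => //; last by rewrite eE.
by rewrite -(index_in_enum j e_mono) -eE index_in_setU1 // ltnn.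
Qed.

Lemma top_face_over (a : 'I_n.+2 -> psort H 1) :
  (forall k (e : 'I_k -> 'I_n.+2) (f : psort H k), (0 < k)%N ->
    {homo e : x y / (x < y)%N} -> face (e @: [set: 'I_k]) f ->
    lies_above f (fun i => a (e i))) ->
  forall i j, lies_above (p i j) (fun x => a (lift i (lift j x))).
Proof.
move=> aP i j; apply: (aP _ (fun x => lift i (lift j x))); first exact: ltnW.
  by move=> x y xy; do 2!apply: ltn_lift.
rewrite (_ : _ @: _ = ~: [set i; lift i j]); first exact: face_top.
apply/eqP; rewrite eqEcard (face_card (face_top i j)) card_imset.
  rewrite cardsT card_ord leqnn andbT.
  apply/subsetP => z /imsetP[x _ ->]; rewrite !inE negb_or.
  by rewrite (inj_eq lift_inj) ![lift _ _ == _]eq_sym !neq_lift.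
by move=> x y /lift_inj/lift_inj.
Qed.

End Faces.

(** * Commutativity of the group, and twists *)

Section AbelianGroup.
Context (G : groupType) (mulgC : forall g h : G, (g * h = h * g)%g).

(** The carrier is unchanged and addition is the product, so [act] serves as the additive action as
    it stands. *)
Definition abelian_zmod : zmodType :=
  HB.pack (Choice.sort G) (GRing.isZmodule.Build G (@mulgA G) mulgC (@mul1g G) (@mulVg G)).

End AbelianGroup.

(** Filling the facets of [n + 1] points from one fiber section gives a compatible tuple, which
    connectedness turns into a Q-tuple. It is needed for commutativity of the group. *)
Lemma qrel_inhabited n (H : structure n) : (2 <= n)%N -> connected H ->
  (exists w : 'I_n.+1 -> psort H 1, injective w) -> exists p, qrel H p.
Proof.
move=> hn Hconn [w w_inj].
have wj_inj (j : 'I_n.+1) : injective (fun i => w (lift j i)).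
  by move=> x y /w_inj/lift_inj.
have [||C HC [s sP]] := exists_filling (k := n) Hconn.
- by rewrite leqnn ltnW.
- by exists (fun i => w (lift ord0 i)).
pose t (j : 'I_n.+1) := s (fun i => w (lift j i)).
have ct : compatible t.
  apply: (hereditary_compatible HC (X := [set: psort H 1]%classic) _ w_inj)
    => [|j|j]; first exact: ltnW.
    by have [] := sP _ (wj_inj j).
  by have [] := sP _ (wj_inj j).
by have [x Qx] := Hconn.2 t ct ord0; exists (upd t ord0 x).
Qed.

(** Move by [g] at positions 0, 1 and by [h] at positions 1, 2, in both orders. The results agree
    except perhaps at position 1, where uniqueness in Q and freeness force [g] and [h] to
    commute. *)
Lemma regular_action_comm n (H : structure n) (G : groupType)
    (act : G -> psort H n -> psort H n) :
  (2 <= n)%N -> quasigroupoid H -> regular_action act ->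
  (exists p, qrel H p) -> (forall g h : G, (g * h = h * g)%g).
Proof.
case: n H act => // -[]// n H act _ [_ _ Qu] [[act1 actM] _ _ act_free act_qrel] [p Qp] g h.
pose i0 : 'I_n.+2 := ord0; pose i1 : 'I_n.+2 := lift ord0 ord0.
have Qgh := act_qrel h _ i1 (act_qrel g _ i0 Qp).
have Qhg := act_qrel g _ i0 (act_qrel h _ i1 Qp).
pose k : 'I_n.+3 := lift ord0 ord0.
have := (Qu _ Qgh k).2 (act g (act h (p k))); rewrite /= -!actM => E.
have {}E : act (h * g)%g (p k) = act (g * h)%g (p k).
  apply: E; move: Qhg; congr qrel; apply: funext => j; rewrite /upd.
  case: (eqVneq j k) => [->|/eqP jk]; first by rewrite /= actM.
  have j1 : (j == 1%N :> nat) = false.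
    by apply/eqP => j1; apply: jk; apply: val_inj.
  by rewrite /= j1 /=; case: (eqVneq (j : nat) 0%N) => [->|].
have /act_free : act ((h * g)^-1 * (g * h))%g (p k) = p k.
  by rewrite actM -E -actM mulVg act1.
by move/(congr1 (fun z => h * g * z)%g); rewrite mulgA mulgV mul1g mulg1.
Qed.

Lemma twist_quasigroupoid n (H : structure n) (G : groupType)
    (act : G -> psort H n -> psort H n) g :
  (2 <= n)%N -> quasigroupoid H -> regular_action act ->
  quasigroupoid (twist act g).
Proof.
move=> hn [cH cQ uQ] [[act1 actM] act_proj _ _ _]; split=> // [p|p] Qp.
  apply: (compatible_eq_proj hn _ (cQ _ Qp)) => i.
  by rewrite /upd; case: eqP => [->|].
move=> i; split=> [|x /= Qx]; first by rewrite upd_id.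
have := (uQ _ Qp i).2; have [iE|iE] := eqVneq i ord_max.
  subst i; move=> /(_ (act g^-1%g x)); rewrite upd_upd upd_same.
  rewrite upd_upd upd_same in Qx; move/(_ Qx)/(congr1 (act g)).
  by rewrite -!actM mulgV !act1.
move=> /(_ x); rewrite upd_neq //; apply; move: Qx; congr qrel.
apply: funext => j; rewrite /upd; case: (eqVneq j ord_max) => [->|//].
by rewrite eq_sym (negPf iE).
Qed.

(** * Homogeneity and constancy of the boundary *)

Section Isomorphisms.
Context {n : nat} {H : structure n}.
Context {a b : 'I_n.+2 -> psort H 1} (a_inj : injective a).

Lemma cl_points k (e : 'I_k -> 'I_n.+2) (x : psort H k) :
  (0 < k <= n)%N -> injective e -> lies_above x (fun i => a (e i)) ->
  cl (points a) k x.
Proof.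
move=> kn; have n0 : (0 < n)%N by case/andP: kn; apply: leq_trans.
have suppa i : supp (points a) (a i) by apply: gen_base => //; exists i.
case: k e x kn => // -[|k] e x kn e_inj xa; first by rewrite [x]xa; apply: suppa.
split=> //; exists (fun i => a (e i)); split=> //.
  by move=> i j /a_inj/e_inj.
exact/lies_above_lies_over.
Qed.

Lemma iso_lies_above f k (e : 'I_k -> 'I_n.+2) (x : psort H k) :
  substructure_iso (cl (points a)) (cl (points b)) f ->
  (forall i, f 1%N (a i) = b i) -> (0 < k <= n)%N -> injective e ->
  lies_above x (fun i => a (e i)) -> lies_above (f k x) (fun i => b (e i)).
Proof.
case=> _ f_proj _ fab; case: k e x => // k; elim: k => [|k IH] e x kn e_inj xa.
  by rewrite [x]xa; apply: fab.
move=> j; rewrite -f_proj //; last exact: cl_points xa.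
apply: (IH (fun i => e (lift j i))); first exact: ltnW kn.
  by move=> i i' /e_inj/lift_inj.
exact: xa.
Qed.

End Isomorphisms.

Section Constancy.
Context {n : nat} (hn : (2 <= n)%N) {H : structure n}.
Context (Hquasi : quasigroupoid H) (Hconn : connected H).
Context {G : groupType} {act : G -> psort H n -> psort H n}.
Context (Hreg : regular_action act) (Hhom : homogeneous_action act).
Context (mulgC : forall g h : G, (g * h = h * g)%g).

Local Open Scope ring_scope.

Let V := abelian_zmod mulgC.
Let vact : V -> psort H n -> psort H n := act.

Let act0 p : vact 0 p = p.
Proof. by have [[act1 _] _ _ _ _] := Hreg; apply: act1. Qed.

Let actD (u v : V) p : vact (u + v) p = vact u (vact v p).
Proof. by have [[_ actM] _ _ _ _] := Hreg; apply: actM. Qed.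

Let act_proj v p : proj (vact v p) = proj p.
Proof. by have [_ actp _ _ _] := Hreg; apply: actp. Qed.

Let act_trans p q : proj p = proj q -> exists v, vact v p = q.
Proof. by have [_ _ actt _ _] := Hreg; apply: actt. Qed.

Let act_free (v : V) p : vact v p = p -> v = 0.
Proof. by have [_ _ _ actf _] := Hreg; apply: actf. Qed.

Let act_qrel (v : V) (p : 'I_n.+1 -> psort H n) (i : 'I_n) : qrel H p ->
  qrel H (fun j => if (j == i :> nat) || (j == i.+1 :> nat)
                   then vact v (p j) else p j).
Proof. by have [_ _ _ _ actq] := Hreg; apply: actq. Qed.

(** An isomorphism carries [p] to a family with the same boundary and the same projections as the
    reference family [q]; the two then differ by a symmetric shift. *)
Lemma boundary_const C (b : 'I_n.+2 -> psort H 1)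
    (p q : 'I_n.+2 -> 'I_n.+1 -> psort H n) :
  fiber_section C -> injective b ->
  (forall i, compatible (p i)) -> symmetric_family p ->
  (forall i j, hereditary C [set: psort H 1]%classic (q i j)) ->
  (forall i j, lies_above (q i j) (fun x => b (lift i (lift j x)))) ->
  symmetric_family q -> @boundary n H V vact p = @boundary n H V vact q.
Proof.
move=> HC b_inj cp sp qC qb sq.
have [a a_inj aP] := vertices_exist hn Hquasi cp sp.
have pa := top_face_over hn aP.
pose F k (f : psort H k) := (2 <= k)%N /\ exists S, face (p := p) S f.
have Finj k (f f' : psort H k) : F k f -> F k f' -> proj f = proj f' -> f = f'.
  case=> k2 [S fS] [_ [S' fS']] ff'.
  have SS' := face_eq_proj hn Hquasi cp sp k2 fS fS' ff'; rewrite -SS' in fS'.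
  exact: (face_unique hn Hquasi cp sp fS fS').
(* This extends the skeleton of [p] to a maximal compatible system on its vertices. *)
have [D HD FD] := exists_fiber_section Finj.
have face_her k S (f : psort H k) : face (p := p) S f -> hereditary D (range a) f.
  case: k f => [|k] f fS; first by have := face_bound hn fS.
  elim: k S f fS => [|k IH] S f fS.
    have /eqP/cards1P[x SE] := face_card fS.
    rewrite (aP 1%N (fun _ => x) f) //; first by exists x.
      by move=> i j; rewrite !ord1.
    rewrite (_ : _ @: _ = S) // SE; apply/setP => z; rewrite inE.
    by apply/imsetP/eqP => [[] //|->]; exists ord0.
  split=> [|j]; first by apply: FD; split=> //; exists S.
  by have [S' /IH] := face_closed j fS.
have n0 : (0 < n <= n)%N by rewrite leqnn ltnW.
have n1 : (1 <= n.-1 <= n.-1)%N by rewrite leqnn andbT -ltnS prednK // ltnW.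
have n2 : (2 <= n <= n)%N by rewrite hn leqnn.
have [f [iso fab fA f_act]] :=
  Hhom a_inj b_inj (hereditary_maximal Hconn HD (range a))
    (hereditary_maximal Hconn HC (range b)) erefl erefl.
have lift2_inj (i : 'I_n.+2) (j : 'I_n.+1) : injective (fun x => lift i (lift j x)).
  by move=> x y /lift_inj/lift_inj.
have pcl v i j : cl (points a) n (vact v (p i j)).
  apply: (cl_points a_inj n0 (lift2_inj i j)).
  by apply: lies_above_eq_proj (pa i j); rewrite ?act_proj.
have pcl0 i j : cl (points a) n (p i j) by have := pcl 0 i j; rewrite act0.
pose fp i j := f n (p i j).
(* The isomorphism preserves [qrel] and commutes with the action, hence preserves the defect of each
   row. *)
transitivity (@boundary n H V vact fp).
  congr altsum; apply: funext => i; apply/esym.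
  apply: (defect_eq Hquasi act0 actD act_free).
  have [_ _ /(_ (upd (p i) ord_max
    (vact (defect (act := vact) (p i)) (p i ord_max))))] := iso.
  case=> [j|+ _]; first by rewrite /upd; case: eqP.
  move=> /(_ (qrel_defect hn Hquasi Hconn act_trans (cp i))).
  congr qrel; apply: funext => j; rewrite /upd; case: eqP => // _.
  exact: f_act.
(* The isomorphism matches the two systems on the sort [n.-1], so both projections are hereditary
   for [C] above the same points. *)
have proj_fp i j : proj (q i j) = proj (fp i j).
  have [_ f_proj _] := iso; apply: funext => x; rewrite /fp -f_proj //.
  apply: (hereditary_unique HC (X := [set: psort H 1]%classic)
      (w := fun y => b (lift i (lift j (lift x y))))).
  - exact: hereditary_proj.
  - apply: (@hereditary_mono _ _ _ (range b)) => //.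
    have : (f n.-1 @` hereditary D (range a) (k := n.-1))%classic
             (f n.-1 (proj (p i j) x)).
      exists (proj (p i j) x) => //; apply: hereditary_proj => //.
      exact: face_her (face_top i j).
    by rewrite fA.
  - exact: (lies_above_proj x hn (qb i j)).
  - apply: (iso_lies_above a_inj iso fab (e := fun y => lift i (lift j (lift x y)))).
    + by case/andP: n1 => -> _; apply: leq_pred.
    + by move=> y z /lift2_inj/lift_inj.
    + exact: (lies_above_proj x hn (pa i j)).
(* The value depends only on the elements [q i j] and [fp i j], so [g] inherits symmetry from [q]
   and [p]. *)
pose g i j : V := xget 0 [set v | vact v (q i j) = fp i j]%classic.
have gE i j : vact (g i j) (q i j) = fp i j.
  have [v vE] := act_trans (proj_fp i j).
  apply: (@xgetPex V 0 [set v | vact v (q i j) = fp i j]%classic).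
  by exists v.
have -> : fp = fun i j => vact (g i j) (q i j).
  by apply: funext => i; apply: funext => j; rewrite gE.
apply: boundary_shift => //.
  move=> i; apply: (hereditary_compatible HC (X := [set: psort H 1]%classic)
    (w := fun x => b (lift i x))) => //.
    exact: ltnW.
  by move=> x y /b_inj/lift_inj.
by move=> i j ij; rewrite /g /fp sq // sp.
Qed.

(** One filling [s] over [n + 3] points gives a reference family [q l] on each set of [n + 2] of
    them, and every family has the boundary of each [q l]. *)
Lemma boundary_value (a : 'I_n.+3 -> psort H 1) : injective a ->
  exists2 c : V, ~~ odd n -> c = 0 &
    forall p, (forall i, compatible (p i)) -> symmetric_family p ->
      @boundary n H V vact p = c.
Proof.
move=> a_inj; have [||C HC [s sP]] := exists_filling (k := n) Hconn.
- by rewrite leqnn ltnW.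
- exists (fun i => a (lift ord0 (lift ord0 (lift ord0 i)))).
  by move=> x y /a_inj/lift_inj/lift_inj/lift_inj.
pose q (l : 'I_n.+3) (i : 'I_n.+2) (j : 'I_n.+1) :=
  s (fun x => a (lift l (lift i (lift j x)))).
have w_inj (l : 'I_n.+3) (i : 'I_n.+2) (j : 'I_n.+1) :
    injective (fun x => a (lift l (lift i (lift j x)))).
  by move=> x y /a_inj/lift_inj/lift_inj/lift_inj.
have q_her l i j : hereditary C [set: psort H 1]%classic (q l i j).
  by have [] := sP _ (w_inj l i j).
have q_above l i j : lies_above (q l i j) (fun x => a (lift l (lift i (lift j x)))).
  by have [] := sP _ (w_inj l i j).
have q_sym l : symmetric_family (q l).
  by move=> i j ij; congr s; apply: funext => x; rewrite lift_lift.
have q_comp l i : compatible (q l i).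
  apply: (hereditary_compatible HC (w := fun x => a (lift l (lift i x))) _ _ (q_her l i)) => //.
    exact: ltnW.
  by move=> x y /a_inj/lift_inj/lift_inj.
have qE p l : (forall i, compatible (p i)) -> symmetric_family p ->
    @boundary n H V vact p = @boundary n H V vact (q l).
  move=> cp sp; apply: (boundary_const HC (b := fun i => a (lift l i))) => //.
  by move=> x y /a_inj/lift_inj.
exists (@boundary n H V vact (q ord0)) => [n_even|p cp sp]; last exact: qE.
(* For [n] even the alternating sum of [n + 3] equal terms is that term. *)
have <- : altsum (fun l => @boundary n H V vact (q l)) =
    @boundary n H V vact (q ord0).
  rewrite -[RHS](_ : altsum (fun _ : 'I_n.+3 => @boundary n H V vact (q ord0)) = _).
    by congr altsum; apply: funext => l; apply: qE.
  by rewrite altsum_const /= n_even.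
(* The row [q l i] depends only on the pair of points it omits, so its defects form a symmetric
   family. *)
apply: altsum_double => l i li; congr defect; apply: funext => j; congr s.
by apply: funext => x; rewrite lift_lift.
Qed.

Lemma boundary_associativity (c : V) :
  (forall p, (forall i, compatible (p i)) -> symmetric_family p ->
     @boundary n H V vact p = altsum (fun _ : 'I_n.+2 => c)) ->
  forall p, (forall i, compatible (p i)) -> symmetric_family p -> forall l,
    (forall i, i != l -> qrel H (upd (p i) ord_max (act c (p i ord_max)))) ->
    qrel H (upd (p l) ord_max (act c (p l ord_max))).
Proof.
move=> bE p cp sp l pl.
have qP t := qrelP hn Hquasi Hconn act0 actD act_trans act_free (t := t) c.
apply/(qP _ (cp l)); apply: (boundary_associative bE cp sp) => i il.
exact/(qP _ (cp i))/pl.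
Qed.

End Constancy.

Theorem theorem2p15 (n : nat) (hn : 2 <= n) (H : structure n)
    (Hquasi : quasigroupoid H) (Hconn : connected H)
    (HI : exists a : 'I_(n + 3) -> psort H 1, injective a)
    (G : groupType) (act : G -> psort H n -> psort H n)
    (Hreg : regular_action act) (Hhom : homogeneous_action act) :
  (odd n -> exists g : G, polygroupoid (twist act g)) /\
  (~~ odd n -> polygroupoid H).
Proof.
have [a a_inj] : exists a : 'I_n.+3 -> psort H 1, injective a.
  have [a a_inj] := HI; have n3 : n.+3 = (n + 3)%N by rewrite addn3.
  by exists (fun i => a (cast_ord n3 i)) => x y /a_inj/cast_ord_inj.
have Q_ex : exists p, qrel H p.
  apply: qrel_inhabited => //; exists (fun i => a (lift ord0 (lift ord0 i))).
  by move=> x y /a_inj/lift_inj/lift_inj.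
have mulgC := regular_action_comm hn Hquasi Hreg Q_ex.
have [c c_even cE] := boundary_value hn Hquasi Hconn Hreg Hhom mulgC a_inj.
split=> [n_odd|n_even].
  (* Twisting by [g] shifts the last entry by the inverse of [g], so this choice makes the
     compatible tuples of defect [c] the new Q-tuples. As [n + 2] is odd, a family with all defects
     equal to [c] has boundary [c]. *)
  exists (c^-1)%g; split; first exact: twist_quasigroupoid.
  have := @boundary_associativity n hn H Hquasi Hconn G act Hreg mulgC c.
  rewrite altsum_const /= negbK n_odd => /(_ cE) assoc p cp sp l pl /=.
  rewrite invgK; apply: assoc => // i il; have := pl i il.
  by rewrite /= invgK.
split=> // p cp sp l pl.
have := @boundary_associativity n hn H Hquasi Hconn G act Hreg mulgC c.
(* Here [n + 2] is even, so constant defects have boundary 0, which is [c]. *)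
rewrite altsum_const /= (negPf n_even) -(c_even n_even) => /(_ cE) assoc.
have [[act1 _] _ _ _ _] := Hreg.
have upd1 t : upd t ord_max (act c (t ord_max)) = t.
  by rewrite (c_even n_even) [act _ _]act1 upd_id.
by rewrite -[p l]upd1; apply: assoc => // i il; rewrite upd1; apply: pl.
Qed.
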